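(* Let $B$ be a band for which $\operatorname{IG}(B)$ satisfies Condition $(P)$. In addition, suppose that $B$ is normal or locally large. Then $\operatorname{IG}(B)$ is an abundant semigroup.
   Context: A band is a semigroup all of whose elements are idempotent. Every band $B$ is a semilattice $Y$ of rectangular bands $B_\alpha$: $B=\bigcup_{\alpha\in Y}B_\alpha$ (disjoint union), each $B_\alpha$ is a rectangular band and $B_\alpha B_\beta\subseteq B_{\alpha\beta}$; $Y$ is ordered by $\alpha\leq\beta$ iff $\alpha\beta=\alpha$. $B$ is normal if it satisfies the identity $xyzx=xzyx$. $B$ is locally large if for all $\alpha,\beta\in Y$ with $\beta>\alpha$, $u\in B_\alpha$ and $v\in B_\beta$, we have $uv=vu=u$. A pair $(e,f)\in B\times B$ is basic if $\{e,f\}\cap\{ef,fe\}\neq\emptyset$. The free idempotent generated semigroup over $B$ is given by the presentation $\operatorname{IG}(B)=\langle \overline{B} : \overline{e}\,\overline{f}=\overline{ef},\ (e,f)\text{ a basic pair}\rangle$ (as a semigroup), where $\overline{B}=\{\overline{e}:e\in B\}$ is a set of symbols in bijection with $B$. A word in the free semigroup $\overline{B}^+$ is also used to denote the element of $\operatorname{IG}(B)$ it represents. A word $\overline{x_1}\cdots\overline{x_n}\in\overline{B}^+$ is in almost normal form if there are $0=i_0<i_1<\cdots<i_r=n$ and $\alpha_1,\ldots,\alpha_r\in Y$ such that $x_j\in B_{\alpha_l}$ whenever $i_{l-1}<j\leq i_l$, and $\alpha_l,\alpha_{l+1}$ are incomparable for all $1\leq l\leq r-1$. Then $r$ is its $Y$-length,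 $i_1,\ldots,i_r=n$ are its left to right significant indices and $\alpha_1,\ldots,\alpha_r$ are its ordered $Y$-components. (Two words in almost normal form representing the same element of $\operatorname{IG}(B)$ have the same $Y$-length and the same ordered $Y$-components.) $\operatorname{IG}(B)$ satisfies Condition $(P)$ if for any two words $\overline{u_1}\cdots\overline{u_n}$ and $\overline{v_1}\cdots\overline{v_m}$ in almost normal form that are equal in $\operatorname{IG}(B)$, of $Y$-length $r$ and with left to right significant indices $i_1,\ldots,i_r=n$ and $l_1,\ldots,l_r=m$ respectively, the following hold (with $i_0=l_0=0$): (i) for all $s\in\{1,\ldots,r\}$, $u_{i_s}\,\mathcal L\,v_{l_s}$ in $B$ implies $\overline{u_1}\cdots\overline{u_{i_s}}=\overline{v_1}\cdots\overline{v_{l_s}}$ in $\operatorname{IG}(B)$; (ii) for all $t\in\{0,\ldots,r-1\}$, $u_{i_t+1}\,\mathcal R\,v_{l_t+1}$ in $B$ implies $\overline{u_{i_t+1}}\cdots\overline{u_n}=\overline{v_{l_t+1}}\cdots\overline{v_m}$ in $\operatorname{IG}(B)$. Here $\mathcal L,\mathcal R$ are Green's relations. For a semigroup $S$: $a\,\mathcal L^*\,b$ iff for all $x,y\in S^1$, $ax=ay\Leftrightarrow bx=by$; $a\,\mathcal R^*\,b$ iff for all $x,y\in S^1$, $xa=ya\Leftrightarrow xb=yb$. $S$ is abundant if each $\mathcal L^*$-class and each $\mathcal R^*$-class contains an idempotent. *)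

(* Defs.v *)
From HB Require Import structures.
From mathcomp Require Import all_boot all_order all_classical.
From Stdlib Require Import Relation_Operators.

Set Implicit Arguments.
Unset Strict Implicit.
Unset Printing Implicit Defensive.

Import Order.TTheory.
Local Open Scope group_scope.
Local Open Scope quotient_scope.

(* S^1 is [option S], [None] being the adjoined identity; if S already has an
   identity this adjoins a new one, which changes neither Green's relations nor
   their starred versions. Only products with one factor in S are needed. *)
Definition mul_r1 (S : semigroupType) (a : S) (x : option S) : S :=
  if x is Some s then a * s else a.
Definition mul_l1 (S : semigroupType) (x : option S) (a : S) : S :=
  if x is Some s then s * a else a.

Definition greenL (S : semigroupType) (a b : S) : Prop :=
  range (fun x => mul_l1 x a) = range (fun x => mul_l1 x b).
Definition greenR (S : semigroupType) (a b : S) : Prop :=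
  range (mul_r1 a) = range (mul_r1 b).

Definition Lstar (S : semigroupType) (a b : S) : Prop :=
  forall x y : option S, mul_r1 a x = mul_r1 a y <-> mul_r1 b x = mul_r1 b y.
Definition Rstar (S : semigroupType) (a b : S) : Prop :=
  forall x y : option S, mul_l1 x a = mul_l1 y a <-> mul_l1 x b = mul_l1 y b.

Definition abundant (S : semigroupType) : Prop :=
  forall a : S, (exists e : S, e * e = e /\ Lstar a e) /\
                (exists f : S, f * f = f /\ Rstar a f).

Definition is_band (B : semigroupType) : Prop := forall x : B, x * x = x.

Definition is_normal (B : semigroupType) : Prop :=
  forall x y z : B, x * y * z * x = x * z * y * x.

(* The fibre of [c] over alpha is B_alpha; the product of Y is [Order.meet]. *)
Record semilattice_of_rectangular_bands (B : semigroupType)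
    (d : Order.disp_t) (Y : meetSemilatticeType d) (c : B -> Y) : Prop := {
  component_surj : forall alpha : Y, exists x : B, c x = alpha;
  component_mul : forall x y : B, c (x * y) = (c x `&` c y)%O;
  component_rect : forall x y : B, c x = c y -> x * y * x = x
}.

Definition locally_large (B : semigroupType)
    (d : Order.disp_t) (Y : meetSemilatticeType d) (c : B -> Y) : Prop :=
  forall alpha beta : Y, (beta > alpha)%O ->
  forall u v : B, c u = alpha -> c v = beta -> u * v = u /\ v * u = u.

(* The pair (a, s) is the nonempty word a :: s. *)
Definition word (A : Type) : Type := A * seq A.
HB.instance Definition _ (A : choiceType) := Choice.on (word A).
Coercion seq_of_word (A : Type) (w : word A) : seq A := w.1 :: w.2.
Definition cat_word (A : Type) (u v : word A) : word A :=
  (u.1, u.2 ++ (v : seq A)).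

Lemma seq_of_cat_word (A : Type) (u v : word A) :
  cat_word u v = u ++ v :> seq A.
Proof. by []. Qed.

(* [letter w j] is the j-th letter, counted from 1. *)
Definition letter (A : Type) (w : word A) (j : nat) : A := nth w.1 w j.-1.

Section IG.
Variable B : semigroupType.

Definition basic_pair (e f : B) : Prop :=
  ([set e; f] `&` [set e * f; f * e] !=set0)%classic.

Variant ig_step : seq B -> seq B -> Prop :=
  IgStep p q e f of basic_pair e f :
    ig_step (p ++ [:: e; f] ++ q) (p ++ [:: e * f] ++ q).

(* Equality in IG(B) of the elements represented by two words. Words are plain
   sequences here, so that prefixes and suffixes need no nonemptiness proof. The
   empty sequence is only related to itself, so on nonempty words this is the
   congruence of the free semigroup generated by the defining relations. *)
Definition ig_eq : seq B -> seq B -> Prop := clos_refl_sym_trans _ ig_step.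

Lemma ig_eq_cat u u' v v' : ig_eq u u' -> ig_eq v v' -> ig_eq (u ++ v) (u' ++ v').
Proof.
move=> uu' vv'; apply: (@rst_trans _ _ _ (u' ++ v)).
- elim: uu' => {u u'} [_ _ [p q e f ef]|u|u u' _|u u' u'' _ + _].
  + by rewrite -!catA; apply: rst_step; constructor.
  + exact: rst_refl.
  + exact: rst_sym.
  + exact: rst_trans.
- elim: vv' => {v v'} [_ _ [p q e f ef]|v|v v' _|v v' v'' _ + _].
  + by rewrite ![u' ++ _ ++ _]catA; apply: rst_step; constructor.
  + exact: rst_refl.
  + exact: rst_sym.
  + exact: rst_trans.
Qed.

Definition ig_rel (u v : word B) : bool := `[< ig_eq u v >].

Lemma ig_rel_refl : reflexive ig_rel.
Proof. by move=> u; apply/asboolP; exact: rst_refl. Qed.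

Lemma ig_rel_sym : symmetric ig_rel.
Proof. by move=> u v; apply/asboolP/asboolP; exact: rst_sym. Qed.

Lemma ig_rel_trans : transitive ig_rel.
Proof.
move=> v u w /asboolP uv /asboolP vw; apply/asboolP.
exact: rst_trans uv vw.
Qed.

Canonical ig_equiv_rel := EquivRel ig_rel ig_rel_refl ig_rel_sym ig_rel_trans.

Definition IG : Type := {eq_quot ig_rel}.
HB.instance Definition _ := Choice.on IG.
HB.instance Definition _ := EqQuotient.on IG.

Lemma ig_eqP (u v : word B) : \pi_IG u = \pi_IG v <-> ig_eq u v.
Proof.
split=> [/eqmodP/asboolP //|uv]; apply/eqmodP; exact/asboolP.
Qed.

Definition ig_mul (x y : IG) : IG := \pi_IG (cat_word (repr x) (repr y)).

Lemma pi_ig_mul (u v : word B) :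
  ig_mul (\pi_IG u) (\pi_IG v) = \pi_IG (cat_word u v).
Proof.
apply/ig_eqP; rewrite !seq_of_cat_word.
by apply: ig_eq_cat; apply/ig_eqP; rewrite reprK.
Qed.

Lemma ig_mulA : associative ig_mul.
Proof.
elim/quotW=> u; elim/quotW=> v; elim/quotW=> w.
rewrite (pi_ig_mul v w) (pi_ig_mul u v) (pi_ig_mul u) (pi_ig_mul _ w).
by rewrite /cat_word /= -catA.
Qed.

HB.instance Definition _ := isSemigroup.Build IG ig_mulA.

End IG.

Section ConditionP.
Variables (B : semigroupType) (d : Order.disp_t) (Y : meetSemilatticeType d).
Variable c : B -> Y.

(* The sequences i_0, ..., i_r and alpha_1, ..., alpha_r are functions on nat
   whose values outside these ranges are irrelevant. *)
Record almost_normal_form (w : word B) (r : nat)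
    (i : nat -> nat) (alpha : nat -> Y) : Prop := {
  anf_first : i 0 = 0;
  anf_last : i r = size w;
  anf_incr : forall l, 1 <= l <= r -> i l.-1 < i l;
  anf_block : forall l j, 1 <= l <= r -> i l.-1 < j <= i l ->
    c (letter w j) = alpha l;
  anf_incomparable : forall l, 1 <= l < r -> (alpha l >< alpha l.+1)%O
}.

Definition condition_P : Prop :=
  forall (u v : word B) (r : nat) (i l : nat -> nat) (alpha beta : nat -> Y),
    almost_normal_form u r i alpha -> almost_normal_form v r l beta ->
    \pi_(IG B) u = \pi_(IG B) v ->
    (forall s, 1 <= s <= r -> greenL (letter u (i s)) (letter v (l s)) ->
       ig_eq (take (i s) u) (take (l s) v)) /\
    (forall t, 0 <= t < r ->
       greenR (letter u (i t).+1) (letter v (l t).+1) ->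
       ig_eq (drop (i t) u) (drop (l t) v)).

End ConditionP.

(* The data assumed in [semilattice_of_rectangular_bands] always exist: Y can be
   taken to be the quotient of the band by its relation J, where
   x y x = x expresses that x lies in the ideal generated by y. *)
Section Decomposition.
Variables (B : semigroupType) (bandB : is_band B).

Definition band_le (x y : B) : bool := x * y * x == x.

Lemma band_le_mul (p x q : B) : band_le (p * x * q) x.
Proof.
apply/eqP; set y := p * x * q.
have yq : y * x * q = y.
  rewrite -[y * x * q]mulgA /y -!mulgA [x * (q * (x * q))]mulgA.
  by rewrite [x * q * _]bandB.
by rewrite -[in X in _ * _ * X = _]yq mulgA bandB yq.
Qed.

Lemma band_le_refl : reflexive band_le.
Proof. by move=> x; rewrite /band_le !bandB. Qed.

Lemma band_le_trans : transitive band_le.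
Proof.
move=> y x z /eqP xy /eqP yz; rewrite -xy -{1}yz.
suff -> : x * (y * z * y) * x = (x * y) * z * (y * x) by exact: band_le_mul.
by rewrite !mulgA.
Qed.

Lemma band_le_mulr x y : band_le (x * y) x.
Proof. by have := band_le_mul x x y; rewrite bandB. Qed.

Lemma band_le_mull x y : band_le (x * y) y.
Proof. by have := band_le_mul x y y; rewrite -mulgA bandB. Qed.

Lemma band_le_comm x y : band_le (x * y) (y * x).
Proof.
have -> : x * y = x * (y * x) * y by rewrite -[LHS]bandB !mulgA.
exact: band_le_mul.
Qed.

Lemma band_le_glb x y z : band_le z x -> band_le z y -> band_le z (x * y).
Proof.
move=> /eqP zx /eqP zy.
have {1}-> : z = (z * x) * z * (y * z) by rewrite zx mulgA zy.
apply: (@band_le_trans ((x * z) * y)).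
  have -> : z * x * z * (y * z) = z * (x * z * y) * z by rewrite !mulgA.
  exact: band_le_mul.
apply: (@band_le_trans (y * (x * z))); first exact: band_le_comm.
apply: (@band_le_trans (y * x)); first by rewrite mulgA; exact: band_le_mulr.
exact: band_le_comm.
Qed.

Definition band_eq (x y : B) : bool := band_le x y && band_le y x.

Lemma band_eq_refl : reflexive band_eq.
Proof. by move=> x; rewrite /band_eq band_le_refl. Qed.

Lemma band_eq_sym : symmetric band_eq.
Proof. by move=> x y; rewrite /band_eq andbC. Qed.

Lemma band_eq_trans : transitive band_eq.
Proof.
move=> y x z /andP[xy yx] /andP[yz zy].
by rewrite /band_eq (band_le_trans xy yz) (band_le_trans zy yx).
Qed.

Canonical band_equiv_rel :=
  EquivRel band_eq band_eq_refl band_eq_sym band_eq_trans.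

Definition band_quot : Type := {eq_quot band_eq}.
HB.instance Definition _ := Choice.on band_quot.
HB.instance Definition _ := EqQuotient.on band_quot.

Definition band_quot_le (a b : band_quot) : bool := band_le (repr a) (repr b).

Definition band_quot_meet (a b : band_quot) : band_quot :=
  \pi_band_quot (repr a * repr b).

Lemma band_repr_le x : band_le (repr (\pi_band_quot x)) x
  /\ band_le x (repr (\pi_band_quot x)).
Proof.
by apply/andP; apply/(@eqmodP _ band_equiv_rel); rewrite reprK.
Qed.

Lemma band_quot_le_refl : reflexive band_quot_le.
Proof. by move=> a; exact: band_le_refl. Qed.

Lemma band_quot_le_anti : antisymmetric band_quot_le.
Proof.
move=> a b ab; rewrite -(reprK a) -(reprK b).
exact/(@eqmodP _ band_equiv_rel).
Qed.

Lemma band_quot_le_trans : transitive band_quot_le.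
Proof. by move=> b a e; exact: band_le_trans. Qed.

HB.instance Definition _ := Order.isPOrder.Build (Order.Disp tt tt) band_quot
  (fun _ _ => erefl) band_quot_le_refl band_quot_le_anti band_quot_le_trans.

Lemma band_quot_lexI (a b e : band_quot) :
  (a <= band_quot_meet b e)%O = ((a <= b) && (a <= e))%O.
Proof.
have [le1 le2] := band_repr_le (repr b * repr e).
apply/idP/andP => [h|[ab ae]].
  have {}h := band_le_trans h le1.
  by split; apply: band_le_trans h _; [exact: band_le_mulr | exact: band_le_mull].
by apply: band_le_trans le2; exact: band_le_glb.
Qed.

HB.instance Definition _ := Order.POrder_isMeetSemilattice.Build
  (Order.Disp tt tt) band_quot band_quot_lexI.

Lemma band_semilattice_of_rectangular_bands :
  exists (d : Order.disp_t) (Y : meetSemilatticeType d) (c : B -> Y),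
    semilattice_of_rectangular_bands c.
Proof.
exists _, band_quot, \pi_band_quot; split.
- by move=> a; exists (repr a); exact: reprK.
- move=> x y; apply/(@eqmodP _ band_equiv_rel)/andP.
  have [x1 x2] := band_repr_le x; have [y1 y2] := band_repr_le y.
  split; apply: band_le_glb.
  + exact: band_le_trans (band_le_mulr _ _) x2.
  + exact: band_le_trans (band_le_mull _ _) y2.
  + exact: band_le_trans (band_le_mulr _ _) x1.
  + exact: band_le_trans (band_le_mull _ _) y1.
- by move=> x y /(@eqmodP _ band_equiv_rel)/andP[/eqP].
Qed.

End Decomposition.

(* Main.v *)
(** On the left side the claim is that a = x_1 ... x_n in almost normal
    form is L*-related to the idempotent x_n, i.e. that a p = a q implies
    x_n p = x_n q. Normalise x_n p and x_n q. The result either still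
    starts with x_n, or starts in a component below that of x_n and then
    absorbs a whole final segment of the blocks of a, leaving a prefix w of
    a followed by new blocks. Comparing the sequences of components of the
    two normal forms shows that a p and a q behave in the same way, with
    the same w and the same first new component. The letter following w is
    the same on both sides if B is normal (there x y x = x z x for y, z in
    one component below x), and the same up to R if B is locally large
    (there the R-classes of the first letters of the blocks are invariants
    of the element). So Condition (P)(ii) cancels w, and what remains of a
    is a product inside one rectangular band, which is cancelled by hand.
    The right side follows by passing to the opposite band. *)

Require Import Defs.
From HB Require Import structures.
From mathcomp Require Import all_boot all_order all_classical.
From Stdlib Require Import Relation_Operators.

Set Implicit Arguments.
Unset Strict Implicit.
Unset Printing Implicit Defensive.

Import Order.TTheory.

(** * Words in the generators of IG(B) *)

Section IGWords.
Local Open Scope group_scope.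
Variable B : semigroupType.
Implicit Types (x y e f : B) (u v w : seq B).

Lemma basic_pairP e f : basic_pair e f <->
  [\/ e * f = e, e * f = f, f * e = e | f * e = f].
Proof.
split=> [[x [/= xef xfe]]|].
  by case: xef xfe => -> [] <-; [apply: Or41|apply: Or43|apply: Or42|apply: Or44].
case=> h; [exists e|exists f|exists e|exists f]; split=> /=; rewrite ?h.
- by left.
- by left.
- by right.
- by left.
- by left.
- by right.
- by right.
- by right.
Qed.

Lemma ig_eq_refl u : ig_eq u u. Proof. exact: rst_refl. Qed.

Lemma ig_eq_sym u v : ig_eq u v -> ig_eq v u. Proof. exact: rst_sym. Qed.

Lemma ig_eq_trans v u w : ig_eq u v -> ig_eq v w -> ig_eq u w.
Proof. exact: rst_trans. Qed.

Lemma ig_eq_catl t u v : ig_eq u v -> ig_eq (t ++ u) (t ++ v).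
Proof. by apply: ig_eq_cat; exact: ig_eq_refl. Qed.

Lemma ig_eq_catr t u v : ig_eq u v -> ig_eq (u ++ t) (v ++ t).
Proof. by move=> uv; apply: ig_eq_cat => //; exact: ig_eq_refl. Qed.

Lemma ig_eq_cons x u v : ig_eq u v -> ig_eq (x :: u) (x :: v).
Proof. exact: (@ig_eq_catl [:: x]). Qed.

Lemma ig_eq_basic e f x u : e * f = x ->
  [\/ x = e, x = f, f * e = e | f * e = f] -> ig_eq [:: e, f & u] (x :: u).
Proof. by move=> <- /basic_pairP ef; apply: rst_step; exact: (IgStep [::]). Qed.

Lemma ig_eq_nilp u v : ig_eq u v -> nilp u = nilp v.
Proof. by elim=> {u v} [_ _ [[|x p] q e f _]|//|//|u v w _ -> _ ->]. Qed.

Lemma greenR_mul x y s t : x = y * s -> y = x * t -> greenR x y.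
Proof.
move=> xE yE; apply/seteqP; split=> _ [[z|] _ <-] /=.
- by exists (Some (s * z)) => //=; rewrite mulgA -xE.
- by exists (Some s).
- by exists (Some (t * z)) => //=; rewrite mulgA -yE.
- by exists (Some t).
Qed.

(** The adjoined identity becomes the empty sequence, so the equations defining [Lstar] turn into
    equations between words. *)
Lemma mul_r1_pi_eq (w : word B) (o o' : option (IG B)) :
  mul_r1 (\pi_(IG B)%qT w : IG B) o = mul_r1 (\pi_(IG B)%qT w : IG B) o' <->
  ig_eq (w ++ oapp (fun z => seq_of_word (repr z)) [::] o)
        (w ++ oapp (fun z => seq_of_word (repr z)) [::] o').
Proof.
have mE (z : option (IG B)) : mul_r1 (\pi_(IG B)%qT w : IG B) z =
    \pi_(IG B)%qT (w.1, w.2 ++ oapp (fun z => seq_of_word (repr z)) [::] z).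
  case: z => [z|] /=; last by rewrite cats0 -surjective_pairing.
  by rewrite -{1}[z]reprK; exact: pi_ig_mul.
by rewrite !mE; exact: ig_eqP.
Qed.

Lemma mul_l1_pi_eq (w : word B) (o o' : option (IG B)) :
  mul_l1 o (\pi_(IG B)%qT w : IG B) = mul_l1 o' (\pi_(IG B)%qT w : IG B) <->
  ig_eq (oapp (fun z => seq_of_word (repr z)) [::] o ++ w)
        (oapp (fun z => seq_of_word (repr z)) [::] o' ++ w).
Proof.
pose cat (z : option (IG B)) : word B :=
  if z is Some z then cat_word (repr z) w else w.
have mE z : mul_l1 z (\pi_(IG B)%qT w : IG B) = \pi_(IG B)%qT (cat z).
  by case: z => [z|] //=; rewrite -{1}[z]reprK; exact: pi_ig_mul.
have catE z : seq_of_word (cat z) =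
    oapp (fun z => seq_of_word (repr z)) [::] z ++ w by case: z.
by rewrite !mE -!catE; exact: ig_eqP.
Qed.

End IGWords.

Section Decomposed.
Local Open Scope group_scope.
Variables (B : semigroupType) (bandB : is_band B).
Variables (d : Order.disp_t) (Y : meetSemilatticeType d) (c : B -> Y).
Hypothesis decB : semilattice_of_rectangular_bands c.
Implicit Types (x y z e f : B) (u v w p q : seq B).

Let cM := component_mul decB.

(** * Rewriting into almost normal form *)

Lemma mul_rect x y : (c x <= c y)%O -> x * y * x = x.
Proof.
move=> xy; have := component_rect decB (_ : c x = c (y * x)).
by rewrite cM meet_r // mulgA => /(_ erefl); rewrite -[x * y * x * x]mulgA bandB.
Qed.

Lemma c_conj x y : (c y <= c x)%O -> c (x * y * x) = c y.
Proof. by move=> yx; rewrite !cM (meet_r yx) meet_l. Qed.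

(** Since x absorbs [y * x] on the right, this letter can be inserted before y and then merged with
    it. *)
Lemma conj_le x y : (c x <= c y)%O -> ig_eq [:: x; y] [:: x; y * x * y].
Proof.
move=> xy; apply: (@ig_eq_trans _ [:: x; y * x; y]).
  apply: (@ig_eq_catr _ [:: y] [:: x] [:: x; y * x]); apply: ig_eq_sym.
  by apply: ig_eq_basic; [rewrite mulgA mul_rect | apply: Or41].
by apply/ig_eq_cons/ig_eq_basic => //; apply: Or43; rewrite mulgA bandB.
Qed.

Lemma conj_ge x y u : (c y <= c x)%O ->
  ig_eq [:: x, y & u] [:: x * y * x, y & u].
Proof.
move=> yx; apply: (@ig_eq_trans _ [:: x, y * x, y & u]).
  apply: ig_eq_cons; apply: ig_eq_sym.
  by apply: ig_eq_basic; [rewrite mul_rect | apply: Or42].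
by rewrite -mulgA; apply: ig_eq_basic => //; apply: Or44; rewrite -mulgA bandB.
Qed.

(** In a rectangular band, left multiplication by [y * x] undoes a leading x that stands before y;
    this drives [rect_cancel]. *)
Lemma rect_absorb x y u : c x = c y -> ig_eq [:: y * x, x, y & u] (y :: u).
Proof.
move=> xy; apply: (@ig_eq_trans _ [:: y * x, y & u]).
  by apply: ig_eq_basic; [rewrite -mulgA bandB | apply: Or41].
by apply: ig_eq_basic; [exact: component_rect decB _ _ (esym xy) | apply: Or42].
Qed.

Lemma rect_cancel w x p q : all (fun y => c y == c x) w ->
  ig_eq (w ++ x :: p) (w ++ x :: q) -> ig_eq (x :: p) (x :: q).
Proof.
elim: w => [|y w IH] //= /andP[/eqP yx wx] h; apply: IH => //.
case: w wx h => [_|z w /= /andP[/eqP zx _]] h.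
  move/(ig_eq_cons (x * y)): h => h.
  apply: ig_eq_trans (rect_absorb q yx).
  by apply: ig_eq_trans h; apply: ig_eq_sym; exact: rect_absorb.
have yz : c y = c z by rewrite yx zx.
move/(ig_eq_cons (z * y)): h => h.
apply: ig_eq_trans (rect_absorb _ yz).
by apply: ig_eq_trans h; apply: ig_eq_sym; exact: rect_absorb.
Qed.

(* Almost normal form, without naming the blocks: a word is in almost normal
   form iff consecutive letters are compatible. *)
Definition compatible x y := (c x == c y) || (c x >< c y)%O.

Notation anf := (sorted compatible).

(** By [conj_le], letters at or above x are drawn down into its component one after another, x
    itself staying in front. Only the first letter of p can lie below x: a later one would be below
    its predecessor, which compatibility excludes. *)
Lemma conj_anf x p : anf p ->
  (exists2 p', ig_eq (x :: p) (x :: p') & anf (x :: p')) \/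
  exists y p', p = y :: p' /\ (c y < c x)%O.
Proof.
elim: p x => [|y p IH] x yp; first by left; exists [::] => //; exact: ig_eq_refl.
have [xy|/negbTE nxy] := boolP (c x <= c y)%O.
  left; have cy := c_conj xy.
  case: (IH (y * x * y) (path_sorted yp)) => [[p' e a]|[z [p' [pE lt]]]].
    exists (y * x * y :: p') => /=; last by rewrite /compatible cy eqxx.
    apply: ig_eq_trans (ig_eq_cons x e).
    exact: (@ig_eq_catr _ p [:: x; y] [:: x; y * x * y] (conj_le xy)).
  move: yp; rewrite pE /= => /andP[+ _]; rewrite /compatible.
  have {}lt : (c z < c y)%O by apply: lt_le_trans xy; rewrite -cy.
  by rewrite (gt_eqF lt) (gt_comparable lt).
have [yx|nyx] := boolP (c y < c x)%O; first by right; exists y, p.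
left; exists (y :: p); first exact: ig_eq_refl.
rewrite /= -/(anf (y :: p)) yp andbT; apply/orP; right.
rewrite /Order.comparable nxy /=; apply: contra nyx => yx.
by rewrite lt_neqAle yx andbT; apply: contraFN nxy => /eqP ->.
Qed.

Lemma anf_exists u : exists2 v, ig_eq u v & anf v.
Proof.
elim: u => [|x u [v uv v_anf]]; first by exists [::] => //; exact: ig_eq_refl.
case: (conj_anf x v_anf) => [[p' e a]|[y [p' [vE lt]]]].
  by exists (x :: p') => //; apply: ig_eq_trans e; exact: ig_eq_cons.
rewrite {v}vE in uv v_anf; exists [:: x * y * x, y & p'].
  by apply: ig_eq_trans (conj_ge _ (ltW lt)); exact: ig_eq_cons.
by rewrite /= in v_anf *; rewrite v_anf /compatible c_conj ?eqxx // ltW.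
Qed.

(** * Sequences of components *)

(* Left multiplication of a word in almost normal form by a letter, recording
   only the first letter of each block. *)
Fixpoint push x s :=
  if s is y :: s' then
    if c x == c y then x :: s'
    else if (c x < c y)%O then push x s'
    else if (c y < c x)%O then s
    else x :: s
  else [:: x].

Definition firsts u := foldr push [::] u.

Lemma push_push_le x y s : (c x <= c y)%O -> push x (push y s) = push x s.
Proof.
move=> xy; elim: s => [|z s IH] /=.
  by case: eqP => // /eqP nxy; rewrite lt_neqAle nxy xy.
case: (comparableP (c y) (c z)) => [yz|zy|yz|yz] /=.
- by rewrite IH (le_lt_trans xy yz) (lt_eqF (le_lt_trans xy yz)).
- by [].
- move: xy; rewrite le_eqVlt; case: eqVneq => [->|_] /=; last by move->.
  rewrite incomparable_eqF // incomparable_ltF // incomparable_ltF //.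
  by rewrite comparable_sym.
- by move: xy; rewrite -yz le_eqVlt; case: eqVneq => //= _ ->.
Qed.

Lemma push_push_gt x y s : (c y < c x)%O -> push x (push y s) = push y s.
Proof.
move=> yx; elim: s => [|z s IH] /=.
  by rewrite (gt_eqF yx) (lt_gtF yx) yx.
case: (comparableP (c y) (c z)) => [yz|zy|yz|yz] //=.
- by rewrite (gt_eqF (lt_trans zy yx)) (lt_gtF (lt_trans zy yx)) (lt_trans zy yx).
- by rewrite (gt_eqF yx) (lt_gtF yx) yx.
- by rewrite (gt_eqF yx) (lt_gtF yx) yx.
Qed.

Section Invariant.
Variables (T : Type) (k : B -> T).
Hypothesis k_c : forall x y, k x = k y -> c x = c y.
Hypothesis k_basic : forall x y, basic_pair x y ->
  k (x * y) = k (if (c x <= c y)%O then x else y).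

Lemma map_push x y s t : k x = k y -> map k s = map k t ->
  map k (push x s) = map k (push y t).
Proof.
move=> xy; elim: s t => [|z s IH] [|z' t] //=; first by rewrite xy.
case=> zz' st; rewrite (k_c xy) (k_c zz').
by case: ifP => _ /=; [|case: ifP => _ /=; [|case: ifP => _ /=]];
  rewrite ?xy ?zz' ?st //; exact: IH.
Qed.

(** The letters of a basic pair have comparable components, so pushing both amounts to pushing the
    lower one, the left one on a tie; by [k_basic] their product has the same value of [k]. Used for
    [c] and, in the locally large case, for the R-class. *)
Lemma map_firsts u v : ig_eq u v -> map k (firsts u) = map k (firsts v).
Proof.
elim=> {u v} [_ _ [p q e f ef]|//|//|u v w _ -> _ ->] //.
rewrite /firsts !foldr_cat /=; set s := foldr push _ q.
have es : map k (push e (push f s)) = map k (push (e * f) s).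
  have kef := k_basic ef; have [le|nle] := boolP (c e <= c f)%O.
    by rewrite push_push_le //; apply: map_push => //; rewrite kef le.
  rewrite (negbTE nle) in kef.
  rewrite push_push_gt; first by apply: map_push.
  suff : (c f <= c e)%O.
    by rewrite le_eqVlt => /orP[/eqP fe|//]; rewrite fe lexx in nle.
  by rewrite leEmeet meetC -cM (k_c kef).
by elim: p => [|x p IH] //=; apply: map_push.
Qed.

End Invariant.

Lemma firsts_cons x u : anf (x :: u) -> firsts (x :: u) = x ::
  if u is y :: _ then if c x == c y then behead (firsts u) else firsts u
  else [::].
Proof.
elim: u x => [|y u IH] x //= /andP[xy yu]; rewrite -!/(firsts _).
have /= -> := IH _ yu; rewrite /=; case: eqP => // /eqP nxy.
move: xy; rewrite /compatible (negbTE nxy) /= => xy.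
by rewrite (incomparable_ltF xy) incomparable_ltF // comparable_sym.
Qed.

Lemma firsts_head x u : anf (x :: u) -> exists s, firsts (x :: u) = x :: s.
Proof. by move/firsts_cons ->; eexists. Qed.

(* A block of the word t ++ x :: u ends where t ends. *)
Definition gap t x := forall t' y, t = rcons t' y -> c y <> c x.

Lemma gap_behead z t x : gap (z :: t) x -> gap t x.
Proof. by move=> g t' y tE; apply: (g (z :: t')); rewrite tE. Qed.

Lemma firsts_cat t x u : anf (t ++ x :: u) -> gap t x ->
  firsts (t ++ x :: u) = firsts t ++ firsts (x :: u).
Proof.
elim: t => [|y t IH] // a g.
have {}IH := IH (path_sorted a) (gap_behead g).
rewrite cat_cons in a *; rewrite firsts_cons // IH.
have yt : anf (y :: t) by move: a; rewrite /= cat_path => /andP[].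
rewrite (firsts_cons yt); case: t {IH} a g yt => [|z t] a g yt /=; last first.
  have [s /= -> /=] := firsts_head (path_sorted yt : anf (z :: t)).
  by case: eqP.
by case: eqP => // yx; case: (g [::] y).
Qed.

Lemma basic_c x y : basic_pair x y ->
  c (x * y) = c (if (c x <= c y)%O then x else y).
Proof.
move=> xy; rewrite cM; case: ifP => [/meet_l //|nxy].
move/basic_pairP: xy => [] /(congr1 c); rewrite cM.
- by move/eqP; rewrite -leEmeet nxy.
- by [].
- by rewrite meetC => /eqP; rewrite -leEmeet nxy.
- by rewrite meetC.
Qed.

Lemma ig_eq_firsts_c u v : ig_eq u v -> map c (firsts u) = map c (firsts v).
Proof. by apply: map_firsts => //; exact: basic_c. Qed.

Lemma greenR_c x y : greenR x y -> c x = c y.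
Proof.
suff le z t : greenR z t -> (c z <= c t)%O.
  by move=> xy; apply/le_anti; rewrite !le.
move=> zt; have : range (mul_r1 t) z by rewrite -zt; exists None.
by case=> -[s|] _ <-; rewrite //= cM leIl.
Qed.

Lemma large_basic_greenR x y : locally_large c -> basic_pair x y ->
  greenR (x * y) (if (c x <= c y)%O then x else y).
Proof.
move=> large xy; have := basic_c xy; case: ifPn => [le|nle].
  move: le; rewrite le_eqVlt => /orP[/eqP cxy _|lt _].
    by apply: (@greenR_mul _ _ _ y x) => //; rewrite (component_rect decB).
  by have [-> _] := large _ _ lt _ _ erefl erefl.
rewrite cM => /meet_idPr; rewrite le_eqVlt => /orP[/eqP cyx|lt].
  by rewrite cyx lexx in nle.
by have [_ ->] := large _ _ lt _ _ erefl erefl.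
Qed.

(** * Absorbing letters into a lower component *)

Lemma split_suffix (a : pred B) w : exists w1 s,
  [/\ w = w1 ++ s, all a s & forall t z, w1 = rcons t z -> ~~ a z].
Proof.
elim: w => [|x w [[|y w1] [s [-> sa w1a]]]]; first by exists [::], [::]; split=> // -[].
  have [xa|nxa] := boolP (a x).
    by exists [::], (x :: s); split=> [//||[]//]; rewrite /= xa.
  exists [:: x], s; split=> // t z; case: t => [[<-] //|? t /= [_]].
  by case: t.
exists [:: x, y & w1], s; split=> // -[//|x' t] z [_]; exact: w1a.
Qed.

Lemma anf_cat w x p :
  anf (rcons w x ++ p) = anf (rcons w x) && path compatible x p.
Proof. by case: w => [|y w] //=; rewrite cat_path last_rcons. Qed.

Lemma split_anf (a : pred B) w x : anf (rcons w x) -> a x -> exists w1 s,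
  [/\ w = w1 ++ s, all a s, anf w1 & forall t z, w1 = rcons t z ->
    ~~ a z /\ exists2 y, a y & compatible z y].
Proof.
move=> wx xa; have [w1 [s [wE sa w1a]]] := split_suffix a w.
exists w1, s; split=> // [|t z w1E].
  by move: wx; rewrite wE -cats1 -catA; case: (w1) => // y t /=; rewrite cat_path => /andP[].
split; first exact: w1a w1E.
move: wx; rewrite wE w1E -cats1 -catA anf_cat => /andP[_].
case: s sa {wE} => [_|y s /= /andP[ya _]] /= /andP[zy _]; first by exists x.
by exists y.
Qed.

(** From right to left, [conj_ge] pushes each letter down into the component of u. As t does not
    depend on p, words that differ only after u are rewritten alike. *)
Lemma absorb_letters (u : B) s : all (fun y => c u <= c y)%O s ->
  exists2 t, all (fun y => c y == c u) t &
    forall p, ig_eq (s ++ u :: p) (t ++ u :: p).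
Proof.
elim: s => [_|x s IH /= /andP[ux /IH[t tu st]]].
  by exists [::] => // p; exact: ig_eq_refl.
have hu : c (head u t) = c u by case: t tu {st} => //= y t /andP[/eqP].
(* [head u t] is the letter that follows x once the rest of s has been replaced. *)
exists (x * head u t * x :: t) => [|p] /=; first by rewrite c_conj hu ?eqxx.
apply: ig_eq_trans (ig_eq_cons x (st p)) _.
by case: t tu {st} hu => [|y t] /= _ hu; apply: conj_ge => //; rewrite hu.
Qed.

Lemma anf_glue w t (u : B) p :
    anf w -> all (fun y => c y == c u) t -> anf (u :: p) ->
  (forall w' z, w = rcons w' z -> (c z >< c u)%O) -> anf (w ++ t ++ u :: p).
Proof.
move=> w_anf tu up wu.
have tup : anf (t ++ u :: p).
  elim: t tu => [|y t IH] //= /andP[/eqP yu tu]; have := IH tu.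
  case: t tu {IH} => [|z t] /= => [_ ->|/andP[/eqP zu _] ->];
    by rewrite /compatible yu ?zu eqxx.
case/lastP: w w_anf wu => [|w z] // w_anf wu; rewrite anf_cat w_anf /=.
have zu := wu _ _ erefl.
by case: t tu tup => [|y t] /= => [_|/andP[/eqP yu _]] ->; rewrite /compatible ?yu zu orbT.
Qed.

(** The predicate [a] marks the letters that u absorbs; x serves as a marked letter compatible with
    the end of w. The last hypothesis makes the letter that stops the absorption incomparable to u,
    which keeps the result in almost normal form. *)
Lemma absorb_into_suffix (a : pred B) w x (u : B) : anf (rcons w x) -> a x ->
    (forall y, a y -> (c u <= c y)%O) ->
    (forall y z, a y -> ~~ a z -> compatible z y -> (c z >< c u)%O) ->
  exists w1 s t, [/\ w = w1 ++ s, all a s, all (fun y => c y == c u) t,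
    forall w' z, w1 = rcons w' z -> (c z >< c u)%O & forall p, anf (u :: p) ->
      anf (w1 ++ t ++ u :: p) /\ ig_eq (w ++ u :: p) (w1 ++ t ++ u :: p)].
Proof.
move=> wx xa ua au; have [w1 [s [-> sa w1_anf w1z]]] := split_anf wx xa.
have [|t tu st] := @absorb_letters u s; first by apply: sub_all sa.
have inc w' z : w1 = rcons w' z -> (c z >< c u)%O.
  by move=> /w1z[nza [y ya zy]]; exact: au zy.
exists w1, s, t; split=> // p up; split; first exact: anf_glue.
by rewrite -catA; apply: ig_eq_catl.
Qed.

Lemma lt_incomparable (u y z : B) : (c u < c y)%O -> ~~ (c u < c z)%O ->
  compatible z y -> (c z >< c u)%O.
Proof.
move=> uy nuz /orP[/eqP zy|]; first by rewrite zy uy in nuz.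
apply: contra => /orP[zu|uz]; first by rewrite /Order.comparable (ltW (le_lt_trans zu uy)).
move: uz; rewrite le_eqVlt (negbTE nuz) orbF => /eqP <-.
by rewrite /Order.comparable (ltW uy).
Qed.

Lemma incomparable_gap w (u : B) :
  (forall w' z, w = rcons w' z -> (c z >< c u)%O) ->
  gap w u.
Proof. by move=> wu w' z /wu /incomparable_eqF/eqP. Qed.

(** A new block opens after w in both words, since a last letter of w in the component of z would be
    above y. The sequences of components then differ right after those of w. *)
Lemma no_larger_continuation w y p z q :
    anf (w ++ y :: p) -> anf (w ++ z :: q) ->
    (forall w' x, w = rcons w' x -> (c x >< c y)%O) -> (c y < c z)%O ->
  ~ ig_eq (w ++ y :: p) (w ++ z :: q).
Proof.
move=> yp zq wy yz /ig_eq_firsts_c.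
have wz : gap w z.
  move=> w' x /wy + xz; rewrite xz; apply/negP/negPn.
  by rewrite /Order.comparable (ltW yz) orbT.
rewrite !firsts_cat //; last exact: incomparable_gap.
have suf v : anf (w ++ v) -> anf v by move/cat_sorted2 => [].
have [s ->] := firsts_head (suf _ yp); have [t ->] := firsts_head (suf _ zq).
rewrite !map_cat => /eqP; rewrite eqseq_cat // eqxx /= => /andP[/eqP yz' _].
by rewrite yz' ltxx in yz.
Qed.

(** Let y absorb the letters above it at the end of w. Where absorption stops, this word continues
    in the component of y, the other one strictly above it. *)
Lemma not_larger_than_last w x y p q : anf (rcons w x) -> anf (y :: p) ->
  anf (x :: q) -> (c y < c x)%O -> ~ ig_eq (w ++ y :: p) (w ++ x :: q).
Proof.
move=> wx yp xq yx.
have [] := @absorb_into_suffix (fun z => c y < c z)%O w x y wx yx.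
- by move=> z; exact: ltW.
- by move=> u z; exact: lt_incomparable.
move=> w1 [s [t [wE sy ty w1y /(_ _ yp)[a e]]]] h.
have {}h := ig_eq_trans (ig_eq_sym e) h.
have [h1 [p1 [tE h1y]]] : exists h1 p1, t ++ y :: p = h1 :: p1 /\ c h1 = c y.
  by case: t ty {a e h} => [|h1 t] /= => [_|/andP[/eqP h1y _]];
    [exists y, p | exists h1, (t ++ y :: p)].
have [b [r [bE yb]]] : exists b r, s ++ x :: q = b :: r /\ (c y < c b)%O.
  by case: s sy {wE} => [|b s] /= => [_|/andP[yb _]];
    [exists x, q | exists b, (s ++ x :: q)].
have wxq : anf (w1 ++ b :: r).
  by rewrite -bE catA -wE -cat_rcons anf_cat wx.
rewrite tE in a h; rewrite wE -catA bE in h.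
by apply: no_larger_continuation h => //; rewrite h1y.
Qed.

(** Let y and z each absorb the end of w, leaving prefixes [w1] and [w2]. Were [w1] shorter, the
    next letter of [w2] would be one that y absorbed, hence above y, against
    [no_larger_continuation]. So the prefixes agree, and the next components with them. *)
Lemma eq_c_first_below w x y p z q : anf (rcons w x) -> anf (y :: p) ->
  anf (z :: q) -> (c y < c x)%O -> (c z < c x)%O ->
  ig_eq (w ++ y :: p) (w ++ z :: q) -> c y = c z.
Proof.
move=> wx yp zq yx zx.
have red (u : B) r : anf (u :: r) -> (c u < c x)%O ->
    exists w1 s h t, [/\ w = w1 ++ s,
    all (fun z => c u < c z)%O s /\ c h = c u,
    forall w' z, w1 = rcons w' z -> (c z >< c u)%O,
    anf (w1 ++ h :: t) & ig_eq (w ++ u :: r) (w1 ++ h :: t)].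
  move=> ur ux.
  have [] := @absorb_into_suffix (fun z => c u < c z)%O w x u wx ux.
  - by move=> ?; exact: ltW.
  - by move=> ? ?; exact: lt_incomparable.
  move=> w1 [s [t [wE su tu w1u /(_ _ ur)[a e]]]].
  case: t tu a e => [|h t] /= => [_|/andP[/eqP hu _]] a e.
    by exists w1, s, u, r.
  by exists w1, s, h, (t ++ u :: r).
have [w1 [s [h [p' [wE [sy hy] w1y wp e]]]]] := red y p yp yx.
have [w2 [s' [h' [q' [wE' [sz hz] w2z wq e']]]]] := red z q zq zx.
move/(ig_eq_trans (ig_eq_sym e))/ig_eq_trans/(_ e') => {e e'} pq.
rewrite -hy -hz.
wlog le12 : w1 w2 s s' h h' p' q' y z {yp zq yx zx}
    wE wE' sy sz hy hz w1y w2z wp wq pq /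
    size w1 <= size w2.
  move=> W; case/orP: (leq_total (size w1) (size w2)) => le12.
    exact: (W w1 w2 s s' h h' p' q' y z).
  by symmetry; apply: (W w2 w1 s' s h' h q' p' z y) => //; exact: ig_eq_sym.
have [[|b r] w2E] : exists r, w2 = w1 ++ r.
  exists (drop (size w1) w2).
  rewrite -{1}(cat_take_drop (size w1) w2); congr (_ ++ _).
  by move: (congr1 (take (size w1)) wE'); rewrite {1}wE take_size_cat // takel_cat.
  rewrite cats0 in w2E; rewrite {}w2E in wq pq w2z.
  move/ig_eq_firsts_c: pq.
  rewrite !firsts_cat //; first last.
  - by apply: incomparable_gap => w' u /w1y; rewrite hy.
  - by apply: incomparable_gap => w' u /w2z; rewrite hz.
  have suf v : anf (w1 ++ v) -> anf v by move/cat_sorted2 => [].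
  have [t ->] := firsts_head (suf _ wp); have [t' ->] := firsts_head (suf _ wq).
  rewrite !map_cat => /eqP; rewrite eqseq_cat // eqxx /= => /andP[/eqP hh' _].
  exact: hh'.
exfalso; rewrite {}w2E -!catA !cat_cons in wq pq wE'.
have yb : (c y < c b)%O.
  move: wE'; rewrite wE => /eqP; rewrite eqseq_cat // eqxx => /eqP sE.
  by move: sy; rewrite sE /= => /andP[].
by apply: no_larger_continuation pq => //; rewrite hy.
Qed.

(** * Condition (P) as a cancellation law *)

(* Condition (P)(ii), and (P)(i) next, for two words sharing the part that is
   to be cancelled. *)
Definition suffix_cancellable := forall w x p y q,
  anf (w ++ x :: p) -> anf (w ++ y :: q) -> gap w x -> gap w y ->
  ig_eq (w ++ x :: p) (w ++ y :: q) -> greenR x y -> ig_eq (x :: p) (y :: q).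

Definition prefix_cancellable := forall w x p y q,
  anf (rcons p x ++ w) -> anf (rcons q y ++ w) ->
  (forall z w', w = z :: w' -> c x <> c z) ->
  (forall z w', w = z :: w' -> c y <> c z) ->
  ig_eq (rcons p x ++ w) (rcons q y ++ w) -> greenL x y ->
  ig_eq (rcons p x) (rcons q y).

(** A letter put in front shifts the positive indices by one and either enlarges the first block or
    opens a new one. The last clause locates a cut between blocks among the indices. *)
Lemma significant_indices x u : anf (x :: u) ->
  exists (i : nat -> nat) (alpha : nat -> Y),
    [/\ i 0 = 0,
        forall l, 0 < l <= size (firsts (x :: u)) -> i l.-1 < i l,
        forall x0 l j, 0 < l <= size (firsts (x :: u)) -> i l.-1 < j <= i l ->
          c (nth x0 (x :: u) j.-1) = alpha l,
        forall l, 0 < l < size (firsts (x :: u)) -> (alpha l >< alpha l.+1)%O &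
        forall v w, x :: u = v ++ w ->
          (forall y w', w = y :: w' -> gap v y) -> i (size (firsts v)) = size v].
Proof.
elim: u x => [|y u IH] x xu.
  exists (fun l => if l is 0 then 0 else 1%N), (fun=> c x); split=> //.
  - by case=> [|[]].
  - by move=> x0 [|[|l]] [|[|j]].
  - by case=> [|[]].
  - by case=> [|z [|z' v]] w.
have yu : anf (y :: u) := path_sorted xu.
have [i [alpha [i0 incr blk inc spl]]] := IH _ yu.
have [s ys] := firsts_head yu.
have s1 : 0 < 1 <= size (firsts (y :: u)) by rewrite ys.
have a1 : alpha 1%N = c y.
  by rewrite -(blk y 1%N 1%N s1) // i0; have := incr 1%N s1; rewrite i0.
rewrite (firsts_cons xu).
have [xy|nxy] := eqVneq (c x) (c y).
  have sz : size (x :: behead (firsts (y :: u))) = size (firsts (y :: u)) by rewrite ys.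
  rewrite {}sz.
  exists (fun l => if l is _.+1 then (i l).+1 else 0), alpha; split=> //.
  - move=> [|[|l]] // h; exact: incr h.
  - move=> x0 [|[|l]] [|[|j]] //; rewrite ?ltnS; first by rewrite a1.
      by move=> h jh; apply: (blk x0 1%N j.+1 h); rewrite i0.
    by move=> h jh; exact: (blk x0 l.+2 j.+1 h jh).
  - move=> [//|z v] w [<-]; case: v => [|z' v] vw g.
      by have := g _ _ (esym vw) [::] x erefl.
    case: vw g => <- uE g.
    have yv : anf (y :: v) by move: yu; rewrite uE /= cat_path => /andP[].
    have xyv : anf [:: x, y & v] by rewrite /= in yv *; rewrite yv /compatible xy eqxx.
    rewrite firsts_cons // xy eqxx.
    have [t yt] := firsts_head yv; rewrite yt /=.
    have := spl (y :: v) w; rewrite yt /= => <- //; first by rewrite uE.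
    move=> b w' /g; exact: gap_behead.
have {}inc' : (c x >< c y)%O.
  by move: xu; rewrite /= /compatible (negbTE nxy) => /andP[].
(* A new first block of length one: index 1 is 0 + 1, and the later blocks are renumbered. *)
exists (fun l => if l is l'.+1 then (i l').+1 else 0),
  (fun l => if l is l'.+2 then alpha l'.+1 else c x); split=> //.
- by move=> [|[|l]] // h; exact: (incr l.+1 h).
- move=> x0 [|[|l]] [|[|j]] //; rewrite ?ltnS ?i0 //.
  by move=> h jh; exact: (blk x0 l.+1 j.+1 h jh).
- move=> [|[|l]] //; first by rewrite a1.
  by move=> h; exact: inc.
- move=> [//|z v] w [<-]; case: v => [|z' v] vw g; first by rewrite /= i0.
  case: vw g => <- uE g.
  have yv : anf (y :: v) by move: yu; rewrite uE /= cat_path => /andP[].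
  have xyv : anf [:: x, y & v] by rewrite /= in yv *; rewrite yv /compatible inc' orbT.
  rewrite firsts_cons // (negbTE nxy) /=.
  rewrite (spl (y :: v) w) //; first by rewrite uE.
  move=> b w' /g; exact: gap_behead.
Qed.

Lemma anf_almost_normal_form x u : anf (x :: u) -> exists i alpha,
  almost_normal_form c (x, u) (size (firsts (x :: u))) i alpha /\
  forall v w, x :: u = v ++ w ->
    (forall y w', w = y :: w' -> gap v y) -> i (size (firsts v)) = size v.
Proof.
move=> /significant_indices[i [alpha [i0 incr blk inc spl]]].
exists i, alpha; split=> //; split=> // [|l j]; last exact: blk.
by apply: (spl _ [::]); rewrite // cats0.
Qed.

(** The gaps make the end of w a significant index of both words, with the same number, and equal
    sequences of components give equal Y-lengths. *)
Lemma condition_P_suffix : condition_P c -> suffix_cancellable.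
Proof.
move=> condP w x p y q xp yq gx gy pq xy.
have [x1 [u1 uE]] : exists x1 u1, w ++ x :: p = x1 :: u1.
  by case: (w) => [|a w1]; [exists x, p | exists a, (w1 ++ x :: p)].
have [y1 [v1 vE]] : exists y1 v1, w ++ y :: q = y1 :: v1.
  by case: (w) => [|a w1]; [exists y, q | exists a, (w1 ++ y :: q)].
have := @anf_almost_normal_form x1 u1; rewrite -uE => /(_ xp)[i [alpha [nfu iE]]].
have := @anf_almost_normal_form y1 v1; rewrite -vE => /(_ yq)[l [beta [nfv lE]]].
have sz := congr1 size (ig_eq_firsts_c pq); rewrite !size_map in sz.
have iw : i (size (firsts w)) = size w.
  by apply: (iE w (x :: p)) => [|? ? [<- _]].
have lw : l (size (firsts w)) = size w.
  by apply: (lE w (y :: q)) => [|? ? [<- _]].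
rewrite -sz in nfv.
have uv : \pi_(IG B)%qT (x1, u1) = \pi_(IG B)%qT (y1, v1).
  by apply/ig_eqP; rewrite /seq_of_word /= -uE -vE.
have [_ /(_ (size (firsts w)))] := condP _ _ _ _ _ _ _ nfu nfv uv.
rewrite iw lw /letter /seq_of_word /= -uE -vE !nth_cat ltnn subnn /= !drop_size_cat //.
apply=> //.
rewrite firsts_cat // size_cat.
have suf v : anf (w ++ v) -> anf v by move/cat_sorted2 => [].
have [s ->] := firsts_head (suf _ xp).
by rewrite /= addnS ltnS leq_addr.
Qed.

(** The prefixes may differ in length, but they have equally many blocks: the totals agree and w
    contributes the same number to each. *)
Lemma condition_P_prefix : condition_P c -> prefix_cancellable.
Proof.
move=> condP w x p y q xp yq gx gy pq xy.
have ne z r : exists z1 r1, rcons r z ++ w = z1 :: r1.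
  by case: r => [|a r1]; [exists z, w | exists a, (rcons r1 z ++ w)].
have [x1 [u1 uE]] := ne x p; have [y1 [v1 vE]] := ne y q.
have := @anf_almost_normal_form x1 u1; rewrite -uE => /(_ xp)[i [alpha [nfu iE]]].
have := @anf_almost_normal_form y1 v1; rewrite -vE => /(_ yq)[l [beta [nfv lE]]].
have sz := congr1 size (ig_eq_firsts_c pq); rewrite !size_map in sz.
have gap_rcons z r : (forall b w', w = b :: w' -> c z <> c b) ->
    forall b w', w = b :: w' -> gap (rcons r z) b.
  move=> g b w' /g zb t a /(congr1 rev); rewrite !rev_rcons => -[<- _]; exact: zb.
have size_firsts z r : anf (rcons r z ++ w) ->
    (forall b w', w = b :: w' -> c z <> c b) ->
    size (firsts (rcons r z ++ w)) = size (firsts (rcons r z)) + size (firsts w).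
  case: w {xp yq gx gy pq ne uE vE iE lE nfu nfv sz} gap_rcons => [|b w'] gap_rcons a g.
    by rewrite cats0 addn0.
  by rewrite firsts_cat ?size_cat //; exact: (gap_rcons _ _ g).
have spq : size (firsts (rcons p x)) = size (firsts (rcons q y)).
  by move: sz; rewrite !size_firsts // => /addIn.
have ip := iE _ _ erefl (gap_rcons _ _ gx).
have lq := lE _ _ erefl (gap_rcons _ _ gy).
rewrite -sz in nfv; rewrite -spq in lq.
have uv : \pi_(IG B)%qT (x1, u1) = \pi_(IG B)%qT (y1, v1).
  by apply/ig_eqP; rewrite /seq_of_word /= -uE -vE.
have [/(_ (size (firsts (rcons p x))))] := condP _ _ _ _ _ _ _ nfu nfv uv.
have nthE z z0 r : nth z0 (rcons r z ++ w) (size (rcons r z)).-1 = z.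
  by rewrite size_rcons nth_cat size_rcons leqnn nth_rcons ltnn eqxx.
rewrite ip lq /letter /seq_of_word /= -uE -vE !nthE !take_size_cat //.
move=> + _; apply=> //; rewrite size_firsts // leq_addr andbT.
have px : anf (rcons p x) by case/cat_sorted2: xp.
by rewrite headI in px *; have [t ->] := firsts_head px.
Qed.

(** * Cancelling all letters but one *)

Hypothesis sufC : suffix_cancellable.

(** With the same u on both sides, absorption changes w in the same way. Then [sufC] removes the
    untouched part, as the letters after it are equal or both u, and [rect_cancel] removes the
    rest. *)
Lemma cancel_same_letter (a : pred B) w x (u : B) p q :
    anf (rcons w x) -> a x -> (forall y, a y -> (c u <= c y)%O) ->
    (forall y z, a y -> ~~ a z -> compatible z y -> (c z >< c u)%O) ->
    anf (u :: p) -> anf (u :: q) ->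
  ig_eq (w ++ u :: p) (w ++ u :: q) -> ig_eq (u :: p) (u :: q).
Proof.
move=> wx xa ua au up uq.
have [w1 [s [t [_ _ tu w1u red]]]] := absorb_into_suffix wx xa ua au.
have [[ap ep] [aq eq]] := (red _ up, red _ uq).
move=> /(ig_eq_trans (ig_eq_sym ep))/ig_eq_trans/(_ eq) pq.
apply: (rect_cancel tu).
case: t tu {ep eq red} ap aq pq => [_|y t /andP[/eqP yu _]] ap aq pq.
  apply: sufC pq _ => //; exact: incomparable_gap.
apply: sufC pq _ => //; by apply: incomparable_gap => w' z /w1u; rewrite yu.
Qed.

Lemma large_absorb s (u : B) p :
  locally_large c -> all (fun y => c u < c y)%O s ->
  ig_eq (s ++ u :: p) (u :: p).
Proof.
move=> large; elim: s => [_|y s IH /= /andP[uy /IH h]]; first exact: ig_eq_refl.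
apply: ig_eq_trans (ig_eq_cons y h) _.
have [_ yu] := large _ _ uy _ _ erefl erefl.
by apply: ig_eq_basic => //; apply: Or42.
Qed.

(** Local largeness deletes the absorbed letters. Although y and z may differ, the R-class of the
    letter after the remaining prefix is an invariant, so [sufC] applies. *)
Lemma cancel_below_large w x y p z q : locally_large c -> anf (rcons w x) ->
  anf (y :: p) -> anf (z :: q) -> (c y < c x)%O -> c y = c z ->
  ig_eq (w ++ y :: p) (w ++ z :: q) -> ig_eq (y :: p) (z :: q).
Proof.
move=> large wx yp zq yx yz pq.
have [] := @absorb_into_suffix (fun z => c y < c z)%O w x y wx yx.
- by move=> ?; exact: ltW.
- by move=> ? ?; exact: lt_incomparable.
move=> w1 [s [t [wE sy _ w1y red]]].
have w1_anf : anf w1.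
  by have [+ _] := red _ yp; move/cat_sorted2 => [].
have w1p : anf (w1 ++ y :: p) by exact: (@anf_glue w1 [::] y).
have w1q : anf (w1 ++ z :: q).
  by apply: (@anf_glue w1 [::] z) => // ? ? /w1y; rewrite yz.
have w1pq : ig_eq (w1 ++ y :: p) (w1 ++ z :: q).
  apply: ig_eq_trans (ig_eq_trans _ pq) _; rewrite wE -catA; apply: ig_eq_catl.
    by apply: ig_eq_sym; exact: large_absorb.
  by apply: large_absorb => //; rewrite -yz.
have gy : gap w1 y by exact: incomparable_gap.
have gz : gap w1 z by move=> ? ? /gy; rewrite yz.
apply: (sufC _ _ _ _ w1pq) => //.
(* Equality of [range (mul_r1 x)] is [greenR] by definition. *)
have inv := @map_firsts _ (fun x => range (mul_r1 x)) greenR_c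
  (fun e f => @large_basic_greenR e f large).
have := inv _ _ w1pq; rewrite !firsts_cat //.
have [t1 ->] := firsts_head yp; have [t2 ->] := firsts_head zq.
rewrite !map_cat => /(congr1 (drop (size (firsts w1)))).
by rewrite !drop_cat size_map ltnn subnn !drop0 => -[].
Qed.

(** Replacing u by [u * v * u] and swapping inner factors by normality gives
    [x * u * x = x * v * u * x]; one more swap identifies the two sides. *)
Lemma conj_normal x y z : is_normal B -> c y = c z -> x * y * x = x * z * x.
Proof.
move=> normal yz.
have conj (u v : B) : c u = c v -> x * u * x = x * v * u * x.
  move=> uv; rewrite -[in LHS](component_rect decB uv).
  have -> : x * (u * v * u) * x = x * u * (v * u) * x by rewrite !mulgA.
  by rewrite normal -!mulgA [u * (u * x)]mulgA bandB.
by rewrite (conj y z) // (conj z y) // normal.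
Qed.

(** This is the nontrivial half of L*-relatedness to the last letter. The four cases record whether
    each normal form keeps x in front or begins below it. *)
Lemma cancel_left w x p q : is_normal B \/ locally_large c -> anf (rcons w x) ->
  ig_eq (w ++ x :: p) (w ++ x :: q) -> ig_eq (x :: p) (x :: q).
Proof.
move=> nl wx pq.
wlog [p_anf q_anf] : p q pq / anf p /\ anf q.
  have [p' pp' p'_anf] := anf_exists p; have [q' qq' q'_anf] := anf_exists q.
  move=> /(_ p' q') W.
  apply: ig_eq_trans (ig_eq_cons x pp') _.
  apply: ig_eq_trans _ (ig_eq_sym (ig_eq_cons x qq')); apply: W => //.
  apply: ig_eq_trans (ig_eq_catl w (ig_eq_cons x qq')).
  apply: ig_eq_trans pq; apply: ig_eq_catl; apply: ig_eq_sym; exact: ig_eq_cons.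
have below y r : anf (y :: r) -> (c y < c x)%O ->
    anf [:: x * y * x, y & r] /\ c (x * y * x) = c y.
  move=> yr yx; have cy := c_conj (ltW yx).
  by rewrite /= in yr *; rewrite yr /compatible cy eqxx.
have no_mix y r s : anf (y :: r) -> anf (x :: s) -> (c y < c x)%O ->
    ~ ig_eq (w ++ [:: x, y & r]) (w ++ x :: s).
  move=> yr xs yx h; have [a cy] := below _ _ yr yx.
  have /(not_larger_than_last wx a xs) : (c (x * y * x) < c x)%O by rewrite cy.
  apply; apply: ig_eq_trans h; apply: ig_eq_catl; apply: ig_eq_sym.
  by apply: conj_ge; exact: ltW.
case: (conj_anf x p_anf) (conj_anf x q_anf) =>
    [[p' pp' p'_anf]|[y [p' [pE yx]]]] [[q' qq' q'_anf]|[z [q' [qE zx]]]].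
- have pq' : ig_eq (w ++ x :: p') (w ++ x :: q').
    apply: ig_eq_trans (ig_eq_catl w qq').
    by apply: ig_eq_trans pq; apply: ig_eq_catl; exact: ig_eq_sym.
  apply: ig_eq_trans pp' _; apply: ig_eq_trans _ (ig_eq_sym qq').
  apply: (@cancel_same_letter (fun y => c y == c x) w x) pq' => //.
  + by move=> ? /eqP ->.
  + by move=> ? ? /eqP <- nz /orP[|//]; rewrite (negbTE nz).
- rewrite {}qE in q_anf pq; case: (no_mix z q' p') => //.
  by apply: ig_eq_trans (ig_eq_sym pq) _; exact: ig_eq_catl.
- rewrite {}pE in p_anf pq; case: (no_mix y p' q') => //.
  by apply: ig_eq_trans pq _; exact: ig_eq_catl.
rewrite {}pE {}qE in p_anf q_anf pq *.
have [yp cy] := below _ _ p_anf yx; have [zq cz] := below _ _ q_anf zx.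
have yE := conj_ge p' (ltW yx); have zE := conj_ge q' (ltW zx).
have pq' : ig_eq (w ++ [:: x * y * x, y & p']) (w ++ [:: x * z * x, z & q']).
  apply: ig_eq_trans (ig_eq_catl w zE).
  by apply: ig_eq_trans pq; apply: ig_eq_catl; exact: ig_eq_sym.
have yz : c y = c z.
  by have := eq_c_first_below wx yp zq _ _ pq'; rewrite cy cz; apply.
case: nl => [normal|large].
  apply: ig_eq_trans yE _; apply: ig_eq_trans _ (ig_eq_sym zE).
  (* Normality identifies the two conjugates, so both words continue with the same letter. *)
  rewrite -(conj_normal x normal yz) in pq' zq *.
  apply: (@cancel_same_letter (fun t => c y < c t)%O w x) pq' => //.
  + by move=> ?; rewrite cy; exact: ltW.
  + by move=> ? ?; rewrite cy; exact: lt_incomparable.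
have yE' : ig_eq [:: x, y & p'] (y :: p').
  have [_ xy] := large _ _ yx _ _ erefl erefl.
  by apply: ig_eq_basic => //; apply: Or42.
have zE' : ig_eq [:: x, z & q'] (z :: q').
  have [_ xz] := large _ _ zx _ _ erefl erefl.
  by apply: ig_eq_basic => //; apply: Or42.
apply: (ig_eq_trans yE'); apply: (ig_eq_trans _ (ig_eq_sym zE')).
apply: (cancel_below_large large wx) => //.
apply: ig_eq_trans (ig_eq_catl w zE').
by apply: ig_eq_trans pq; apply: ig_eq_catl; exact: ig_eq_sym yE'.
Qed.

End Decomposed.

(** * The opposite band *)

Definition opposite (B : semigroupType) : Type := B.

Section Opposite.
Local Open Scope group_scope.
Variable B : semigroupType.

HB.instance Definition _ := Choice.on (opposite B).

Lemma opposite_mulA : associative (fun x y : opposite B => (y : B) * x).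
Proof. by move=> x y z; rewrite mulgA. Qed.

HB.instance Definition _ := isSemigroup.Build (opposite B) opposite_mulA.

Lemma opposite_basic_pair (e f : B) :
  @basic_pair (opposite B) f e <-> basic_pair e f.
Proof.
have swap P Q R S : [\/ P, Q, R | S] -> [\/ Q, P, S | R].
  by case=> h; [apply: Or42|apply: Or41|apply: Or44|apply: Or43].
by split=> /basic_pairP/swap h; apply/basic_pairP.
Qed.

Lemma ig_eq_opposite (u v : seq B) :
  @ig_eq (opposite B) u v <-> ig_eq (rev u) (rev v).
Proof.
split.
  elim=> {u v} [_ _ [p q e f ef]|u|u v _|u v w _ + _].
  - rewrite !rev_cat -!catA; apply/ig_eq_catl/ig_eq_catr.
    apply: rst_step; apply: (@IgStep B [::] [::] f e); exact/opposite_basic_pair.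
  - exact: ig_eq_refl.
  - exact: ig_eq_sym.
  - exact: ig_eq_trans.
rewrite -{2}[u]revK -{2}[v]revK.
elim=> {u v} [_ _ [p q e f ef]|u|u v _|u v w _ + _].
- rewrite !rev_cat -!catA; apply/ig_eq_catl/ig_eq_catr.
  apply: rst_step; apply: (@IgStep (opposite B) [::] [::] f e); exact/opposite_basic_pair.
- exact: ig_eq_refl.
- exact: ig_eq_sym.
- exact: ig_eq_trans.
Qed.

Variables (d : Order.disp_t) (Y : meetSemilatticeType d) (c : B -> Y).

Lemma opposite_decomposition : semilattice_of_rectangular_bands c ->
  @semilattice_of_rectangular_bands (opposite B) d Y c.
Proof.
case=> surj cM rect; split=> // x y; first by rewrite cM meetC.
by move/rect; rewrite -mulgA.
Qed.

Lemma sorted_compatible_rev (u : seq B) :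
  sorted (compatible c) (rev u) = sorted (compatible c) u.
Proof.
rewrite rev_sorted; apply: eq_sorted => x y.
by rewrite /compatible eq_sym comparable_sym.
Qed.

Lemma opposite_suffix_cancellable : prefix_cancellable c ->
  @suffix_cancellable (opposite B) d Y c.
Proof.
move=> preC w x p y q xp yq gx gy /ig_eq_opposite pq xy; apply/ig_eq_opposite.
have revE (z : B) r : rev (w ++ z :: r) = rcons (rev r) z ++ rev w.
  by rewrite rev_cat rev_cons.
rewrite !rev_cons; apply: (preC (rev w)).
- by rewrite -revE sorted_compatible_rev.
- by rewrite -revE sorted_compatible_rev.
- by move=> z w' wE; apply/nesym/(gx (rev w')); rewrite -rev_cons -wE revK.
- by move=> z w' wE; apply/nesym/(gy (rev w')); rewrite -rev_cons -wE revK.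
- by rewrite -!revE.
(* [greenR] of the opposite band unfolds to [greenL] of B. *)
- exact: xy.
Qed.

End Opposite.

(** * Right cancellation and abundance *)

Section Cancel.
Local Open Scope group_scope.
Variables (B : semigroupType) (bandB : is_band B).
Variables (d : Order.disp_t) (Y : meetSemilatticeType d) (c : B -> Y).
Hypothesis decB : semilattice_of_rectangular_bands c.
Hypothesis condP : condition_P c.
Hypothesis nl : is_normal B \/ locally_large c.

(** This is [cancel_left] in the opposite band with the words reversed, fed by condition (P)(i) for
    B. *)
Lemma cancel_right x w p q : sorted (compatible c) (x :: w) ->
  ig_eq (p ++ x :: w) (q ++ x :: w) -> ig_eq (rcons p x) (rcons q x).
Proof.
move=> xw pq.
rewrite -[rcons p x]revK -[rcons q x]revK; apply/(@ig_eq_opposite B).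
rewrite !rev_rcons.
apply: (@cancel_left (opposite B) _ d Y c _ _ (rev w)).
- exact: bandB.
- exact: opposite_decomposition.
- exact/opposite_suffix_cancellable/condition_P_prefix.
- case: nl => [normal|large]; [left|right].
    by move=> x' y z; rewrite /mul /= !mulgA normal.
  by move=> a b ab u v ua vb; have [? ?] := large a b ab u v ua vb.
- by rewrite -rev_cons sorted_compatible_rev.
apply/ig_eq_opposite.
by rewrite !rev_cat !rev_cons !revK !cat_rcons.
Qed.

End Cancel.

Theorem proposition7p2 (B : semigroupType) (bandB : is_band B)
    (d : Order.disp_t) (Y : meetSemilatticeType d) (c : B -> Y)
    (decB : semilattice_of_rectangular_bands c)
    (condP : condition_P c)
    (normal_or_large : is_normal B \/ locally_large c) :
  abundant (IG B).
Proof.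
elim/quotW=> w0.
have [v wv v_anf] := anf_exists bandB decB w0.
have idem x : (\pi_(IG B)%qT (x, [::]) * \pi_(IG B)%qT (x, [::]) =
    \pi_(IG B)%qT (x, [::]) :> IG B)%g.
  apply: (eq_trans (pi_ig_mul (x, [::]) (x, [::]))); apply/ig_eqP.
  change (ig_eq [:: x; x] [:: x]).
  by apply: ig_eq_basic; [exact: bandB | apply: Or41].
case: v wv v_anf => [/ig_eq_nilp //|x u wv xu].
have -> : \pi_(IG B)%qT w0 = \pi_(IG B)%qT (x, u) by apply/ig_eqP.
split.
  (* The last letter is the idempotent of the L*-class: one implication is [cancel_left], the other
     is left multiplication by the remaining letters. *)
  exists (\pi_(IG B)%qT (last x u, [::])); split; first exact: idem.
  move=> o o'; split=> /mul_r1_pi_eq h; apply/mul_r1_pi_eq;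
    move: h; rewrite /seq_of_word /=.
    rewrite -!cat_cons lastI !cat_rcons.
    apply: (cancel_left bandB decB (condition_P_suffix decB condP)) => //.
    by rewrite -lastI.
  by move/(ig_eq_catl (belast x u)); rewrite -!cat_rcons -lastI.
(* Dually, the first letter is the idempotent of the R*-class. *)
exists (\pi_(IG B)%qT (x, [::])); split; first exact: idem.
move=> o o'; split=> /mul_l1_pi_eq h; apply/mul_l1_pi_eq;
  move: h; rewrite /seq_of_word /=.
  by move/(cancel_right bandB decB condP normal_or_large xu); rewrite -!cats1.
by move/(ig_eq_catr u); rewrite -!catA.
Qed.
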